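(* If $S$ is a dense subset of $\mathbb{R}^2$, then $h(S)\leq 4$. This bound is sharp, i.e., there exists a dense subset $S\subset\mathbb{R}^2$ with $h(S)=4$.
   Context: For $S\subseteq\mathbb{R}^d$, the $S$-Helly number $h(S)$ is the smallest positive integer $h$ such that for every $m\in\mathbb{N}$ and all sets $F_1,\dots,F_m$ of the form $F_i=S\cap K_i$ with $K_i\subset\mathbb{R}^d$ convex, the following implication holds: if $F_{i_1}\cap\cdots\cap F_{i_h}\neq\emptyset$ for all $i_1,\dots,i_h\in\{1,\dots,m\}$, then $F_1\cap\cdots\cap F_m\neq\emptyset$. If no such $h$ exists, $h(S):=\infty$. *)

(* Defs.v *)
From mathcomp Require Import all_boot all_order all_algebra.
From mathcomp Require Import all_classical all_reals all_analysis.

Set Implicit Arguments.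
Unset Strict Implicit.
Unset Printing Implicit Defensive.

Import Order.TTheory GRing.Theory Num.Theory.
Import numFieldNormedType.Exports.

Local Open Scope classical_set_scope.
Local Open Scope ring_scope.

(* [t : 'I_h -> 'I_m] ranges over arbitrary, possibly repeating, h-tuples of
   indices.  For [m = 0] the conclusion is trivial, an empty [\bigcap] being
   [setT]. *)
Definition helly_property (R : realType) (d : nat) (S : set 'rV[R]_d)
    (h : nat) : Prop :=
  forall (m : nat) (F : 'I_m -> set 'rV[R]_d),
    (forall i, exists2 K : set (convex_lmodType 'rV[R]_d),
       convex_set K & F i = S `&` K) ->
    (forall t : 'I_h -> 'I_m, \bigcap_(j in [set: 'I_h]) F (t j) !=set0) ->
    \bigcap_(i in [set: 'I_m]) F i !=set0.

Definition helly_bound (R : realType) (d : nat) (S : set 'rV[R]_d) : pred nat :=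
  fun h => (0 < h)%N && `[< helly_property S h >].

Definition helly_number (R : realType) (d : nat) (S : set 'rV[R]_d) : \bar R :=
  match pselect (exists h, helly_bound S h) with
  | left ex_h => ((ex_minn ex_h)%:R)%:E
  | right _ => +oo%E
  end.

(* Main.v *)
Require Import Defs.
From mathcomp Require Import all_boot all_order all_algebra.
From mathcomp Require Import all_classical all_reals all_analysis.
From mathcomp Require Import ring lra.
Import Order.TTheory GRing.Theory Num.Theory.
Import numFieldNormedType.Exports.
Local Open Scope classical_set_scope.
Local Open Scope ring_scope.

(** As in Radon's proof of Helly's theorem, [h] is an upper bound for the Helly
    number of [S] as soon as, for any [h + 1] points of [S], the convex hulls of
    all but one of them have a common point in [S]
    ([helly_property_criterion]).

    For [h = 4] and [S] dense in the plane, take five points of [S]. If one of them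
    is in the hull of the others, it is common to all five hulls. Otherwise the
    points form a convex pentagon, and the hulls of four of them meet in the inner
    pentagon cut out by the diagonals. It has nonempty interior, so it meets
    [S] ([dense_meets_five_hulls]). The proof finds an open part of the inner
    pentagon without ordering the vertices. An affine dependence of four of the
    points has two coefficients of each sign, hence gives two crossing segments
    [a b] and [c d]; the point sought lies close to the crossing, in the
    direction of the fifth point [e] ([crossing_triangles]). Every hull of four
    contains one of the three triangles [a b e], [c d e], [a b c].

    The bound is attained by the plane without the origin: the four closed
    half-planes bounded by the axes meet only at the origin, whereas any three
    of them have a common nonzero point ([punctured_plane_helly_gt3]). *)

Set Implicit Arguments.
Unset Strict Implicit.
Unset Printing Implicit Defensive.

(** * Convex combinations *)

Lemma convex_combination2 (R : realType) (E : lmodType R)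
    (K : set (convex_lmodType E)) (t : R) (x y : E) :
  convex_set K -> 0 <= t -> t <= 1 -> K x -> K y ->
  K (t *: x + (1 - t) *: y).
Proof.
move=> cK t0 t1 Kx Ky.
have := cK x y (Itv01 t0 t1) (mem_set Kx) (mem_set Ky).
by move/set_mem.
Qed.

(** Dividing by the total weight, rather than asking it to be 1, lets the
    induction on the list keep the same form for its tail. *)
Lemma convex_combination (R : realType) (E : lmodType R)
    (K : set (convex_lmodType E)) (I : Type) (s : seq I) (w : I -> R)
    (x : I -> E) :
  convex_set K -> (forall i, 0 <= w i) -> (forall i, 0 < w i -> K (x i)) ->
  0 < \sum_(i <- s) w i ->
  K ((\sum_(i <- s) w i)^-1 *: (\sum_(i <- s) w i *: x i)).
Proof.
move=> cK w0 Kx; elim: s => [|i s IH]; first by rewrite big_nil ltxx.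
rewrite !big_cons.
have [wi0|wi0] := eqVneq (w i) 0; first by rewrite wi0 scale0r !add0r.
have wi_gt0 : 0 < w i by rewrite lt0r wi0 w0.
have Ki := Kx _ wi_gt0.
set W := \sum_(j <- s) w j in IH *.
have W0 : 0 <= W by apply: sumr_ge0.
move=> WW; have WWn0 := lt0r_neq0 WW.
have [W_eq0|Wn0] := eqVneq W 0.
  suff -> : \sum_(j <- s) w j *: x j = 0.
    by rewrite W_eq0 !addr0 scalerA mulVf // scale1r.
  move: W_eq0; rewrite /W; elim: (s) => [|j s' IHs]; first by rewrite !big_nil.
  rewrite !big_cons => /eqP; rewrite paddr_eq0 ?sumr_ge0 // => /andP[/eqP -> /eqP].
  by rewrite scale0r add0r; exact: IHs.
have Kr := IH (_ : 0 < W); rewrite lt0r Wn0 W0 in Kr; have {}Kr := Kr isT.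
have := convex_combination2 (t := w i / (w i + W)) cK _ _ Ki Kr.
rewrite scalerA scalerDr scalerA.
have -> : (1 - w i / (w i + W)) / W = (w i + W)^-1.
  by field; rewrite WWn0.
rewrite [_^-1 * _]mulrC; apply.
- by rewrite divr_ge0 // ltW.
- by rewrite ler_pdivrMr // mul1r lerDl.
Qed.

Lemma convex_combination3 (R : realType) (E : lmodType R)
    (K : set (convex_lmodType E)) (u v w : R) (a b c : E) :
  convex_set K -> 0 < u -> 0 < v -> 0 < w -> u + v + w = 1 ->
  K a -> K b -> K c -> K (u *: a + v *: b + w *: c).
Proof.
move=> cK u0 v0 w0 uvw Ka Kb Kc.
pose W (i : 'I_3) := [:: u; v; w]`_i; pose X (i : 'I_3) := [:: a; b; c]`_i.
have := @convex_combination R E K _ (index_enum 'I_3) W X cK.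
rewrite !big_ord_recl !big_ord0 /W /X /= !addr0 !addrA uvw invr1 scale1r; apply=> //.
- by case=> -[|[|[|]]] // *; exact: ltW.
- by case=> -[|[|[|]]].
Qed.

(** * Affine dependences and their signs *)

(** The convex hull of the points [x j] with [j <> i], as the intersection of
    all convex sets that contain these points. *)
Definition hull_without (R : realType) (E : lmodType R) (I : Type)
    (x : I -> E) (i : I) (p : E) :=
  forall K : set (convex_lmodType E), convex_set K ->
    (forall j, j <> i -> K (x j)) -> K p.

Definition redundant (R : realType) (E : lmodType R) (I : Type)
    (x : I -> E) (i : I) := hull_without x i (x i).

Definition affine_dependence (R : realType) (E : lmodType R) (I : finType)
    (x : I -> E) (l : I -> R) :=
  \sum_i l i = 0 /\ \sum_i l i *: x i = 0.

Lemma affine_dependenceN (R : realType) (E : lmodType R) (I : finType)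
    (x : I -> E) (l : I -> R) :
  affine_dependence x l -> affine_dependence x (fun i => - l i).
Proof.
move=> [l0 lx0]; split; first by rewrite sumrN l0 oppr0.
by under eq_bigr do rewrite scaleNr; rewrite sumrN lx0 oppr0.
Qed.

(** Solving the dependence for the point of the lone negative coefficient
    writes it as a convex combination of the others. *)
Lemma redundant_lone_sign (R : realType) (E : lmodType R) (I : finType)
    (x : I -> E) (l : I -> R) (i : I) :
  affine_dependence x l -> l i < 0 -> (forall j, j != i -> 0 <= l j) ->
  redundant x i.
Proof.
move=> [l0 lx0] li l_ge0 K cK Kx.
pose w j := if j == i then 0 else l j.
have wi : w i = 0 by rewrite /w eqxx.
have wl j : j != i -> w j = l j by move=> /negPf ji; rewrite /w ji.
have wE : \sum_j w j = - l i.
  apply: (@addrI _ (l i)); rewrite subrr -[RHS]l0 (bigD1 i) //= wi add0r.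
  by rewrite [RHS](bigD1 i) //=; congr (_ + _); exact: eq_bigr.
have wxE : \sum_j w j *: x j = - (l i *: x i).
  apply: (@addrI _ (l i *: x i)); rewrite subrr -[RHS]lx0 (bigD1 i) //=.
  rewrite wi scale0r add0r [RHS](bigD1 i) //=; congr (_ + _).
  by apply: eq_bigr => j /wl ->.
have := @convex_combination R E K I (index_enum I) w x cK.
rewrite wE wxE -scaleNr scalerA mulVf ?oppr_eq0 ?(ltr0_neq0 li) // scale1r.
apply.
- by move=> j; rewrite /w; case: eqVneq => // /l_ge0.
- by move=> j; rewrite /w; case: eqVneq => [_|/eqP ji _]; [rewrite ltxx|exact: Kx].
- by rewrite oppr_gt0.
Qed.

Lemma two_positive (R : realType) (E : lmodType R) (I : finType)
    (x : I -> E) (l : I -> R) (k : I) :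
  (forall i, ~ redundant x i) -> affine_dependence x l -> l k != 0 ->
  exists a b, [/\ a != b, 0 < l a & 0 < l b].
Proof.
move=> nr dl lk.
have [[a la]|/forallNP np] := pselect (exists a, 0 < l a); last first.
  have := dl.1 => /eqP; rewrite -oppr_eq0 -sumrN psumr_eq0; last first.
    by move=> i _; rewrite oppr_ge0 leNgt; apply/negP/np.
  by move=> /allP /(_ k (mem_index_enum k)) /=; rewrite oppr_eq0 (negPf lk).
have [[b [ba lb]]|/forallNP np] := pselect (exists b, b != a /\ 0 < l b).
  by exists a, b; rewrite eq_sym.
case: (nr a); apply: (redundant_lone_sign (affine_dependenceN dl)).
  by rewrite oppr_lt0.
move=> j ja; rewrite oppr_ge0 leNgt; apply/negP => lj; exact: (np j).
Qed.

(** This is the source of Radon partitions: a nonzero dependence has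
    coefficients of both signs, and a sign occurring only once would make a point
    redundant. *)
Lemma two_by_two_signs (R : realType) (E : lmodType R) (I : finType)
    (x : I -> E) (l : I -> R) (k : I) :
  (forall i, ~ redundant x i) -> affine_dependence x l -> l k != 0 ->
  exists a b c d, [/\ 0 < l a, 0 < l b, l c < 0, l d < 0 & uniq [:: a; b; c; d]].
Proof.
move=> nr dl lk; have [a [b [ab la lb]]] := two_positive nr dl lk.
have [|c [d [cd lc ld]]] := two_positive nr (affine_dependenceN dl) (k := k).
  by rewrite oppr_eq0.
rewrite !oppr_gt0 in lc ld.
exists a, b, c, d; split=> //=.
have ne i j : 0 < l i -> l j < 0 -> i != j.
  by move=> li lj; apply/eqP => ij; move: li; rewrite ij ltNge (ltW lj).
by rewrite !inE !negb_or ab cd !ne.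
Qed.

(** The dependences that vanish at [e] form the kernel of a matrix with only
    [d + 2] columns: the coordinates, the constant 1 and the indicator of [e]. *)
Lemma affine_dependence_avoiding (R : realType) (d n : nat)
    (x : 'I_n -> 'rV[R]_d) (e : 'I_n) :
  (d + 2 < n)%N ->
  exists2 l : 'I_n -> R, affine_dependence x l & l e = 0 /\ exists k, l k != 0.
Proof.
move=> dn.
pose M : 'M[R]_(n, d + (1 + 1)) :=
  row_mx (\matrix_i x i) (row_mx (const_mx 1) (delta_mx e 0)).
have : kermx M != 0.
  rewrite -mxrank_eq0 mxrank_ker subn_eq0 -ltnNge.
  exact: leq_ltn_trans (rank_leq_col M) dn.
case/rowV0Pn => v /sub_kermxP; rewrite /M !mul_mx_row => vM v0.
have /eq_row_mx[vx /eq_row_mx[v1 ve]] : row_mx (v *m \matrix_i x i)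
    (row_mx (v *m const_mx 1) (v *m delta_mx e 0)) =
    row_mx (0 : 'rV[R]_d) (row_mx (0 : 'cV[R]_1) (0 : 'cV[R]_1)).
  by rewrite vM !row_mx0.
exists (v 0).
  split.
    have /rowP/(_ 0) := v1; rewrite !mxE => sum_v; rewrite -[RHS]sum_v.
    by apply: eq_bigr => i _; rewrite !mxE mulr1.
  by rewrite -[RHS]vx mulmx_sum_row; apply: eq_bigr => i _; rewrite rowK.
split.
  have /rowP/(_ 0) := ve; rewrite !mxE (bigD1 e) //= big1 => [|i ie].
    by rewrite !mxE !eqxx mulr1 addr0.
  by rewrite !mxE (negPf ie) mulr0.
apply/existsP; apply: contraR v0; rewrite negb_exists => /forallP v0.
by apply/eqP/rowP => k; rewrite mxE; apply/eqP; have := v0 k; rewrite negbK.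
Qed.

(** * From hulls of h + 1 points to the Helly number *)

(** Induction on the number of sets: if dropping any one of the [h + 1] sets
    [F (a k)] from the family leaves a common point [x k], then a set of the
    family contains every [x k] except possibly the one obtained by dropping that
    very set, so it contains the point [p] of [S] common to the hulls of all
    but one of the [x k]. *)
Lemma helly_property_criterion (R : realType) (d h : nat) (S : set 'rV[R]_d) :
  (0 < h)%N ->
  (forall x : 'I_h.+1 -> 'rV[R]_d, (forall i, S (x i)) ->
    exists2 p, S p & forall i, hull_without x i p) ->
  helly_property S h.
Proof.
move=> h0 core m F cF tF.
suff key n (A : {set 'I_m}) : (#|A| <= n)%N ->
    exists p, forall i, i \in A -> F i p.
  have [p Fp] := key _ [set: 'I_m]%SET (leqnn _).
  by exists p => i _; apply: Fp; rewrite inE.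
elim: n => [|n IH] in A *.
  rewrite leqn0 cards_eq0 => /eqP ->; exists 0 => i; by rewrite inE.
move=> An; have [->|[a0 a0A]] := set_0Vmem A.
  by exists 0 => i; rewrite inE.
have [Ah|Ah] := leqP #|A| h.
  have [p Fp] := tF (fun j => nth a0 (enum A) j).
  exists p => i iA.
  have ih : (index i (enum A) < h)%N.
    by apply: leq_trans Ah; rewrite cardE index_mem mem_enum.
  have /= := Fp (Ordinal ih) I; by rewrite nth_index // mem_enum.
pose a (i : 'I_h.+1) := nth a0 (enum A) i.
have a_lt (i : 'I_h.+1) : (i < size (enum A))%N.
  by rewrite -cardE (leq_trans (ltn_ord i)).
have aA i : a i \in A by rewrite -mem_enum mem_nth.
have a_inj i j : a i = a j -> i = j.
  move=> /eqP; rewrite nth_uniq ?a_lt ?enum_uniq // => /eqP ij; exact: val_inj.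
have ex_x i : exists p, forall j, j \in (A :\ a i)%SET -> F j p.
  by apply: IH; rewrite -ltnS; move: An; rewrite (cardsD1 (a i)) aA.
have [x Fx] := choice ex_x.
have FK : forall i, exists K : set (convex_lmodType 'rV[R]_d),
    convex_set K /\ F i = S `&` K.
  by move=> i; have [K cK FE] := cF i; exists K.
have [K KP] := choice FK.
have FaS j p : F j p -> S p by rewrite (KP j).2 => -[].
have Sx i : S (x i).
  have [k ki] : exists k : 'I_h.+1, k != i.
    have [->|i0] := eqVneq i ord0; last by exists ord0; rewrite eq_sym.
    by exists ord_max; rewrite -val_eqE /= -lt0n.
  apply: (@FaS (a k)); apply: Fx; rewrite !inE aA andbT.
  by apply: contra_neq ki; exact: a_inj.
have [p Sp Kp] := core x Sx.
exists p => j jA; rewrite (KP j).2; split=> //.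
(* Any index serves as [i] when [F j] is not among the [h + 1] chosen sets. *)
have [i ai] : exists i, forall k, k <> i -> j != a k.
  have [[i ->]|/forallNP na] := pselect (exists i, j = a i).
    by exists i => k ki; apply/eqP => /a_inj /esym.
  by exists ord0 => k _; apply/eqP/na.
apply: (Kp i _ (KP j).1) => k ki.
have : F j (x k) by apply: Fx; rewrite !inE jA ai.
by rewrite (KP j).2 => -[].
Qed.

Lemma helly_number_le (R : realType) (d h : nat) (S : set 'rV[R]_d) :
  (0 < h)%N -> helly_property S h -> (helly_number S <= h%:R%:E)%E.
Proof.
move=> h0 Sh; have bh : helly_bound S h by rewrite /helly_bound h0; apply/asboolP.
rewrite /helly_number; case: pselect => [ex_h|[]]; last by exists h.
by case: ex_minnP => m _ /(_ h bh); rewrite lee_fin ler_nat.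
Qed.

Lemma helly_number_ge (R : realType) (d n : nat) (S : set 'rV[R]_d) :
  (forall h, (h < n)%N -> ~ helly_property S h) ->
  (n%:R%:E <= helly_number S)%E.
Proof.
move=> Sn; rewrite /helly_number; case: pselect => [ex_h|_]; last exact: leey.
case: ex_minnP => m /andP[_ /asboolP Sm] _; rewrite lee_fin ler_nat leqNgt.
by apply/negP => /Sn.
Qed.

(** * Triangles in the plane *)

(** Twice the signed area of the triangle [p q r]; it is affine in each point
    and ratios of its values are barycentric coordinates. *)
Definition orient (R : realType) (p q r : 'rV[R]_2) : R :=
  (q 0 0 - p 0 0) * (r 0 1 - p 0 1) - (q 0 1 - p 0 1) * (r 0 0 - p 0 0).

(** The interior of the triangle [a b c]. Multiplying by [orient a b c] makes
    the description independent of the orientation, and it leaves no point at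
    all when [a], [b], [c] are collinear. *)
Definition in_triangle (R : realType) (a b c p : 'rV[R]_2) :=
  [/\ 0 < orient a b c * orient p b c, 0 < orient a b c * orient a p c
    & 0 < orient a b c * orient a b p].

Lemma rV2P (R : realType) (p q : 'rV[R]_2) :
  p 0 0 = q 0 0 -> p 0 1 = q 0 1 -> p = q.
Proof.
move=> pq0 pq1; apply/rowP; case=> -[|[|//]] k.
- by have -> : Ordinal k = 0 by exact: val_inj.
- by have -> : Ordinal k = 1 by exact: val_inj.
Qed.

Lemma convex_triangle (R : realType) (K : set (convex_lmodType 'rV[R]_2))
    (a b c p : 'rV[R]_2) :
  convex_set K -> K a -> K b -> K c -> in_triangle a b c p -> K p.
Proof.
move=> cK Ka Kb Kc [pa pb pc].
have D0 : orient a b c != 0.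
  by apply: contraTneq pa => ->; rewrite mul0r ltxx.
have pos z : 0 < orient a b c * z -> 0 < z / orient a b c.
  move=> h; have -> : z / orient a b c = (orient a b c * z) / orient a b c ^+ 2.
    by field.
  by rewrite divr_gt0 // exprn_even_gt0.
have -> : p = (orient p b c / orient a b c) *: a +
  (orient a p c / orient a b c) *: b + (orient a b p / orient a b c) *: c.
  apply: rV2P; rewrite !mxE; move: D0; rewrite /orient => D0; by field.
apply: convex_combination3 => //; try exact: pos.
by move: D0; rewrite /orient => D0; field.
Qed.

Lemma open_positive_multiple (R : realType) (f : 'rV[R]_2 -> R) (k : R) :
  continuous f -> open [set p | 0 < k * f p].
Proof.
move=> cf.
apply: (@open_comp _ _ (fun p => k * f p) [set y | y > 0]); last exact: open_gt.
by move=> p _; exact: (cvgM (cvg_cst k) (cf p)).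
Qed.

Lemma open_in_triangle (R : realType) (a b c : 'rV[R]_2) :
  open [set p | in_triangle a b c p].
Proof.
have cc i : continuous (fun p : 'rV[R]_2 => p 0 i) by exact: coord_continuous.
have cB (f g : 'rV[R]_2 -> R) :
    continuous f -> continuous g -> continuous (fun p => f p - g p).
  by move=> cf cg p; exact: (cvgB (cf p) (cg p)).
have cM (f g : 'rV[R]_2 -> R) :
    continuous f -> continuous g -> continuous (fun p => f p * g p).
  by move=> cf cg p; exact: (cvgM (cf p) (cg p)).
have ck (k : R) : continuous (fun _ : 'rV[R]_2 => k) by exact: cst_continuous.
have -> : [set p | in_triangle a b c p] =
  [set p | 0 < orient a b c * orient p b c] `&`
  [set p | 0 < orient a b c * orient a p c] `&`
  [set p | 0 < orient a b c * orient a b p].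
  by apply/seteqP; split=> p /= => [[? ? ?]|[[? ?] ?]].
by apply: openI; [apply: openI|]; apply: open_positive_multiple; rewrite /orient;
  apply cB; apply cM; apply cB; (exact: cc || exact: ck).
Qed.

Lemma small_step (R : realType) (A B X Y : R) : 0 < A -> 0 < B ->
  exists2 t, 0 < t < 1 & 0 < A + t * X /\ 0 < B + t * Y.
Proof.
move=> A0 B0.
have step (C Z : R) : 0 < C -> exists2 s, 0 < s < 1 & forall t, 0 < t <= s -> 0 < C + t * Z.
  move=> C0; have D0 : 0 < C + `|Z| + 1 by have := normr_ge0 Z; lra.
  exists (C / (C + `|Z| + 1)).
    rewrite divr_gt0 //= ltr_pdivrMr // mul1r; have := normr_ge0 Z; lra.
  move=> t /andP[t0]; rewrite ler_pdivlMr // => tC.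
  have := ler_norm (- Z); rewrite normrN => ?; nra.
have [s /andP[s0 s1] sA] := step A X A0; have [t /andP[t0 t1] tB] := step B Y B0.
exists (Num.min s t); first by rewrite lt_min s0 t0 gt_min s1.
by split; [apply: sA|apply: tB]; rewrite lt_min s0 t0 ge_min lexx ?orbT.
Qed.

(** The witness is [r + h (e - r)], where [r] is the crossing point of the
    segments [a b] and [c d]. For every [0 < h < 1] it is interior to the
    triangles with apex [e] over these two segments, because [r] is interior to
    both. It is interior to [a b c] for small [h], because [r] is interior to the
    side [a b], and moving towards [e] enters the side of [a b] on which [c]
    lies. *)
Lemma crossing_triangles (R : realType) (a b c d e : 'rV[R]_2) (s t : R) :
  0 < s < 1 -> 0 < t < 1 ->
  s *: a + (1 - s) *: b = t *: c + (1 - t) *: d ->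
  orient c d e != 0 -> 0 < orient a b c * orient a b e ->
  exists p, [/\ in_triangle a b e p, in_triangle c d e p & in_triangle a b c p].
Proof.
move=> /andP[s0 s1] /andP[t0 t1] rE cde abce.
have s1' : 0 < 1 - s by rewrite subr_gt0.
have t1' : 0 < 1 - t by rewrite subr_gt0.
have abc0 : orient a b c != 0 by apply: contraTneq abce => ->; rewrite mul0r ltxx.
have abe0 : orient a b e != 0 by apply: contraTneq abce => ->; rewrite mulr0 ltxx.
have sq z : z != 0 :> R -> 0 < z * z by rewrite -expr2 exprn_even_gt0.
pose r := s *: a + (1 - s) *: b.
have [h /andP[h0 h1] [ha hb]] := small_step
  (orient a b c * (orient e b c - s * orient a b c))
  (orient a b c * (orient a e c - (1 - s) * orient a b c))
  (mulr_gt0 s0 (sq _ abc0)) (mulr_gt0 s1' (sq _ abc0)).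
have h1' : 0 < 1 - h by rewrite subr_gt0.
pose p := (1 - h) *: r + h *: e.
have pE i : p 0 i = (1 - h) * (s * a 0 i + (1 - s) * b 0 i) + h * e 0 i.
  by rewrite !mxE.
have pE' i : p 0 i = (1 - h) * (t * c 0 i + (1 - t) * d 0 i) + h * e 0 i.
  by rewrite /p /r rE !mxE.
exists p; split; split.
- have -> : orient p b e = (1 - h) * s * orient a b e by rewrite /orient !pE; ring.
  by rewrite mulrCA; apply: mulr_gt0; rewrite ?sq ?mulr_gt0.
- have -> : orient a p e = (1 - h) * (1 - s) * orient a b e.
    by rewrite /orient !pE; ring.
  by rewrite mulrCA; apply: mulr_gt0; rewrite ?sq ?mulr_gt0.
- have -> : orient a b p = h * orient a b e by rewrite /orient !pE; ring.
  by rewrite mulrCA; apply: mulr_gt0; rewrite ?sq ?mulr_gt0.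
- have -> : orient p d e = (1 - h) * t * orient c d e.
    by rewrite /orient !pE'; ring.
  by rewrite mulrCA; apply: mulr_gt0; rewrite ?sq ?mulr_gt0.
- have -> : orient c p e = (1 - h) * (1 - t) * orient c d e.
    by rewrite /orient !pE'; ring.
  by rewrite mulrCA; apply: mulr_gt0; rewrite ?sq ?mulr_gt0.
- have -> : orient c d p = h * orient c d e by rewrite /orient !pE'; ring.
  by rewrite mulrCA; apply: mulr_gt0; rewrite ?sq ?mulr_gt0.
- by move: ha; congr (0 < _); rewrite /orient !pE; ring.
- by move: hb; congr (0 < _); rewrite /orient !pE; ring.
- have -> : orient a b p = h * orient a b e by rewrite /orient !pE; ring.
  by rewrite mulrCA mulr_gt0.
Qed.

(** The coefficients [q i - r i], [r i - p i], [p i - q i] given by the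
    coordinate [i] annihilate the constants and the coordinate [i] identically,
    and the other coordinate up to [orient p q r]. They vanish for both [i] only
    if the three points coincide. *)
Lemma collinear_dependence (R : realType) (p q r : 'rV[R]_2) :
  orient p q r = 0 ->
  exists u v w, [/\ u + v + w = 0, u *: p + v *: q + w *: r = 0
                  & [|| u != 0, v != 0 | w != 0]].
Proof.
move=> pqr.
pose cyc i := (q 0 i - r 0 i, r 0 i - p 0 i, p 0 i - q 0 i).
have cyc_dep i : (cyc i).1.1 + (cyc i).1.2 + (cyc i).2 = 0 /\
    (cyc i).1.1 *: p + (cyc i).1.2 *: q + (cyc i).2 *: r = 0.
  split; first by rewrite /=; ring.
  move: pqr; rewrite /orient => pqr.
  have [->|->] : i = 0 \/ i = 1.
  - by case: i => -[|[|//]] k; [left|right]; exact: val_inj.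
  - by apply: rV2P; rewrite !mxE /=; nra.
  - by apply: rV2P; rewrite !mxE /=; nra.
have [c0|c0] := boolP [|| (cyc 0).1.1 != 0, (cyc 0).1.2 != 0 | (cyc 0).2 != 0].
  by exists (cyc 0).1.1, (cyc 0).1.2, (cyc 0).2; have [? ?] := cyc_dep 0.
have [c1|c1] := boolP [|| (cyc 1).1.1 != 0, (cyc 1).1.2 != 0 | (cyc 1).2 != 0].
  by exists (cyc 1).1.1, (cyc 1).1.2, (cyc 1).2; have [? ?] := cyc_dep 1.
exists 1, (-1), 0; rewrite oner_neq0 addr0 subrr scale0r scale1r scaleN1r addr0.
split=> //; apply/eqP; rewrite subr_eq0; apply/eqP.
move: c0 c1; rewrite !negb_or !negbK /= !subr_eq0.
by move=> /and3P[_ _ /eqP c0] /and3P[_ _ /eqP c1]; exact: rV2P.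
Qed.

(** * The hulls of four among five points *)

Lemma ord5_bigE (V : nmodType) (f : 'I_5 -> V) (a b c d e : 'I_5) :
  uniq [:: a; b; c; d; e] -> \sum_i f i = f a + f b + f c + f d + f e.
Proof.
move=> u; have pE : perm_eq (index_enum 'I_5) [:: a; b; c; d; e].
  apply: uniq_perm => //; first exact: index_enum_uniq.
  move=> i; rewrite mem_index_enum; apply/esym.
  apply: (subset_cardP _ _ : [:: a; b; c; d; e] =i predT) => //.
    by rewrite (card_uniqP u) card_ord.
  exact: subset_predT.
by rewrite (perm_big _ pE) /= !big_cons big_nil addr0 !addrA.
Qed.

(** Three collinear points carry a dependence with only three nonzero
    coefficients, which is too few for two of each sign. *)
Lemma irredundant_orient (R : realType) (I : finType) (x : I -> 'rV[R]_2) (i j k : I) :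
  (forall i, ~ redundant x i) -> uniq [:: i; j; k] ->
  orient (x i) (x j) (x k) != 0.
Proof.
move=> nr /= /andP[]; rewrite !inE negb_or => /andP[ij ik] /andP[jk _].
apply/eqP => /collinear_dependence[u [v [w [uvw0 uvwx uvwn0]]]].
pose l m := if m == i then u else if m == j then v else if m == k then w else 0.
have li : l i = u by rewrite /l eqxx.
have lj : l j = v by rewrite /l eq_sym (negPf ij) eqxx.
have lk : l k = w by rewrite /l ![k == _]eq_sym (negPf ik) (negPf jk) eqxx.
have l0 m : l m != 0 -> m \in [:: i; j; k].
  by rewrite /l !inE; case: (m == i); case: (m == j); case: (m == k); rewrite // eqxx.
have sum3 (V : nmodType) (f : I -> V) :
    (forall m, m \notin [:: i; j; k] -> f m = 0) ->
    \sum_m f m = f i + f j + f k.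
  move=> f0; rewrite (bigD1 i) //= (bigD1 j) 1?eq_sym //= (bigD1 k) /=; last first.
    by rewrite ![k == _]eq_sym ik jk.
  rewrite big1 ?addr0 ?addrA // => m /andP[/andP[mi mj] mk].
  by apply: f0; rewrite !inE !negb_or mi mj.
have dl : affine_dependence x l.
  split; rewrite sum3 ?li ?lj ?lk // => m mn.
    by apply: contraNeq mn; exact: l0.
  by rewrite (_ : l m = 0) ?scale0r //; apply: contraNeq mn; exact: l0.
have [m lm] : exists m, l m != 0.
  by case/or3P: uvwn0 => h; [exists i; rewrite li|exists j; rewrite lj|exists k; rewrite lk].
have [a [b [c [d [la lb lc ld u4]]]]] := two_by_two_signs nr dl lm.
have := uniq_leq_size u4 (_ : {subset _ <= [:: i; j; k]}); rewrite ltnn.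
suff /[swap]/[apply] : {subset [:: a; b; c; d] <= [:: i; j; k]} by [].
move=> n nabcd; apply: l0; move: nabcd; rewrite !inE.
by case/or4P => /eqP ->; rewrite ?(gt_eqF la, gt_eqF lb, lt_eqF lc, lt_eqF ld).
Qed.

(** A redundant point itself belongs to every hull of four. Otherwise four of
    the points span crossing segments [a b] and [c d], and with the fifth point
    [e] the open triangles [a b e], [c d e] and [a b c] have a common point. Each of
    the five points is missed by one of these triangles, so each hull of four
    contains the open nonempty intersection of the three, where [S] has a
    point. *)
Lemma dense_meets_five_hulls (R : realType) (S : set 'rV[R]_2) (x : 'I_5 -> 'rV[R]_2) :
  dense S -> (forall i, S (x i)) ->
  exists2 p, S p & forall i, hull_without x i p.
Proof.
move=> dS Sx.
have [[i ri]|/forallNP nr] := pselect (exists i, redundant x i).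
  exists (x i) => // k K cK; have [<-|ik] := pselect (i = k); first exact: ri.
  by apply.
pose e : 'I_5 := ord_max.
have [l dl [le [k lk]]] := affine_dependence_avoiding x e isT.
have [a [b [c [d [la lb lc ld u4]]]]] := two_by_two_signs nr dl lk.
have ne m : l m != 0 -> m != e by apply: contraNneq => ->; rewrite le.
have [ae be ce de] : [/\ a != e, b != e, c != e & d != e].
  by split; apply: ne; rewrite ?(gt_eqF la, gt_eqF lb, lt_eqF lc, lt_eqF ld).
have u5 : uniq [:: a; b; c; d; e].
  by rewrite (rcons_uniq [:: a; b; c; d] e) u4 !inE !negb_or ![e == _]eq_sym ae be ce de.
have [] := dl; rewrite !(ord5_bigE _ u5) le scale0r !addr0 => l0 lx0.
have lab : 0 < l a + l b by rewrite addr_gt0.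
have lcd : l c + l d = - (l a + l b) by apply/eqP; rewrite -addr_eq0 addrC addrA l0.
have lab0 := lt0r_neq0 lab.
pose s := l a / (l a + l b); pose t := - l c / (l a + l b).
have s01 : 0 < s < 1 by rewrite divr_gt0 //= ltr_pdivrMr // mul1r ltrDl.
have t01 : 0 < t < 1.
  by rewrite divr_gt0 ?oppr_gt0 //= ltr_pdivrMr // mul1r -[l a + l b]opprK -lcd ltrN2 gtrDl.
have rE : s *: x a + (1 - s) *: x b = t *: x c + (1 - t) *: x d.
  have -> : 1 - s = l b / (l a + l b) by rewrite /s; field.
  have -> : 1 - t = - l d / (l a + l b).
    have -> : l d = - (l a + l b) - l c by rewrite -lcd; ring.
    by rewrite /t; field.
  rewrite /s /t ![_ / (l a + l b)]mulrC -!scalerA -!scalerDr; congr (_ *: _).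
  by rewrite !scaleNr; apply/eqP; rewrite -subr_eq0 !opprD !opprK !addrA lx0.
(* Name the endpoints of the second segment so that the first of them lies
   on the same side of the line through [x a] and [x b] as [x e]. *)
have [c' [d' [t' [tE' c'd' t01' ccw]]]] : exists c' d' t',
    [/\ s *: x a + (1 - s) *: x b = t' *: x c' + (1 - t') *: x d',
        uniq [:: a; b; c'; d'; e], 0 < t' < 1 &
        0 < orient (x a) (x b) (x c') * orient (x a) (x b) (x e)].
  have [abce|abce] := ltP 0 (orient (x a) (x b) (x c) * orient (x a) (x b) (x e)).
    by exists c, d, t.
  exists d, c, (1 - t); rewrite subKr [_ + t *: _]addrC; split=> //.
  - move: u5; rewrite /= !inE !negb_or [d == c]eq_sym.
    by move=> /and5P[/and4P[-> -> -> ->] /and3P[-> -> ->] /andP[-> ->] -> _].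
  - by case/andP: t01 => t0 t1; rewrite subr_gt0 t1 ltrBlDr ltrDl.
  have abe0 : orient (x a) (x b) (x e) != 0.
    exact: irredundant_orient nr (mask_uniq u5 [:: true; true; false; false; true]).
  have abc0 : orient (x a) (x b) (x c) != 0.
    exact: irredundant_orient nr (mask_uniq u5 [:: true; true; true]).
  have {}abce : orient (x a) (x b) (x c) * orient (x a) (x b) (x e) < 0.
    by rewrite lt_neqAle abce andbT mulf_neq0.
  have /andP[t0 t1] := t01.
  have abd : (1 - t) * orient (x a) (x b) (x d) = - t * orient (x a) (x b) (x c).
    have rEi m : s * x a 0 m + (1 - s) * x b 0 m = t * x c 0 m + (1 - t) * x d 0 m.
      by have /rowP/(_ m) := rE; rewrite !mxE.
    apply/eqP; rewrite mulNr -addr_eq0 /orient; apply/eqP.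
    transitivity ((x b 0 0 - x a 0 0) * ((t * x c 0 1 + (1 - t) * x d 0 1) - x a 0 1)
      - (x b 0 1 - x a 0 1) * ((t * x c 0 0 + (1 - t) * x d 0 0) - x a 0 0)).
      by ring.
    by rewrite -!rEi; ring.
  rewrite -(@pmulr_rgt0 _ (1 - t)) ?subr_gt0 // mulrA abd -mulrA mulNr.
  by rewrite oppr_gt0 pmulr_rlt0.
have nr3 := irredundant_orient nr (mask_uniq c'd' [:: false; false; true; true; true]).
have [p0 p0P] := crossing_triangles s01 t01' tE' nr3 ccw.
pose O := [set p | in_triangle (x a) (x b) (x e) p] `&`
  ([set p | in_triangle (x c') (x d') (x e) p] `&`
   [set p | in_triangle (x a) (x b) (x c') p]).
have [|| p [[abe [cde abc]] Sp]] := dS O.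
- by exists p0; case: p0P.
- by do 2?apply: openI; exact: open_in_triangle.
exists p => // i K cK Kx.
move: c'd'; rewrite /= !inE !negb_or => /and5P[/and4P[_ ac ad ae'] /and3P[bc bd be'] /andP[cd ce'] de' _].
(* Use one of the three triangles that does not have [x i] as a vertex. *)
have [ei|ei] := eqVneq i e.
  by apply: (convex_triangle cK _ _ _ abc); apply: Kx; apply/eqP; rewrite ei.
have [ai|ai] := eqVneq i a.
  by apply: (convex_triangle cK _ _ _ cde); apply: Kx; apply/eqP; rewrite ai eq_sym.
have [bi|bi] := eqVneq i b.
  by apply: (convex_triangle cK _ _ _ cde); apply: Kx; apply/eqP; rewrite bi eq_sym.
by apply: (convex_triangle cK _ _ _ abe); apply: Kx; apply/eqP; rewrite eq_sym.
Qed.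

(** * Sharpness: the punctured plane *)

Lemma dense_punctured_plane (R : realType) : dense (~` [set (0 : 'rV[R]_2)]).
Proof.
move=> O [x Ox] oO; have [x0|/eqP x0] := eqVneq x 0; last by exists x.
move: Ox; rewrite {x}x0 => O0.
have /nbhs_ballP[e /= e0 eO] := open_nbhs_nbhs (conj oO O0).
have e2 : 0 < e / 2 by rewrite divr_gt0.
exists (const_mx (e / 2)); split=> /=.
  apply: eO; split=> // i j; rewrite /ball /= !mxE sub0r normrN gtr0_norm //.
  by rewrite ltr_pdivrMr // ltr_pMr // ltr1n.
by move/rowP/(_ 0); rewrite !mxE => h; move: e2; rewrite h ltxx.
Qed.

Definition constrained_coord (i : 'I_4) : 'I_2 := if (i < 2)%N then 0 else 1.

(** In order of the index: right, left, upper and lower half-plane. *)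
Definition half_plane (R : realType) (i : 'I_4) :
    set (convex_lmodType 'rV[R]_2) :=
  [set p : 'rV[R]_2 | 0 <= (-1) ^+ i * p 0 (constrained_coord i)].

Lemma convex_half_plane (R : realType) (i : 'I_4) : convex_set (@half_plane R i).
Proof.
move=> p q t /set_mem pi /set_mem qi; apply/mem_set.
rewrite /half_plane /= in pi qi *; rewrite !mxE mulrDr.
rewrite [X in X + _]mulrCA [X in _ + X]mulrCA.
by apply: addr_ge0; apply: mulr_ge0 => //; rewrite subr_ge0.
Qed.

(** The four closed half-planes bounded by the coordinate axes meet only at the
    origin, but any three of them share a unit vector or its opposite. Fewer
    than four indices always leave out one half-plane. *)
Lemma punctured_plane_helly_gt3 (R : realType) (h : nat) :
  (h < 4)%N -> ~ helly_property (~` [set (0 : 'rV[R]_2)]) h.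
Proof.
move=> h4 /(_ 4%N (fun i => ~` [set 0] `&` @half_plane R i)) [].
- by move=> i; exists (@half_plane R i) => //; exact: convex_half_plane.
- move=> t; have [i it] : exists i, i \notin codom t.
    apply/existsP; rewrite -negb_forall; apply/negP => /forallP tT.
    have := leq_image_card t predT; rewrite card_ord leqNgt.
    by rewrite (eq_card (B := predT)) ?card_ord ?h4.
  (* The outward unit normal of the half-plane [i]. *)
  exists (- (-1) ^+ i *: delta_mx 0 (constrained_coord i)) => j _; split => /=.
    move=> /rowP/(_ (constrained_coord i)); rewrite !mxE !eqxx mulr1 => /eqP.
    by rewrite oppr_eq0 signr_eq0.
  have : t j != i by apply: contraNneq it => <-; exact: codom_f.
  rewrite /half_plane /= !mxE eqxx /=; move: (t j) => k {it}.
  by case: i k => -[|[|[|[|//]]]] ? [] [|[|[|[|//]]]] ? //= _;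
    rewrite ?(expr0, expr1, sqrrN, expr1n, exprS) /=; lra.
- move=> p pF; have [p_neq0 _] := pF ord0 I; apply: p_neq0.
  have Hp k (k4 : (k < 4)%N) := (pF (Ordinal k4) I).2.
  have := Hp 0%N isT; have := Hp 1%N isT; have := Hp 2%N isT; have := Hp 3%N isT.
  rewrite /half_plane /constrained_coord /= !exprS !expr0 => h3 h2 h1 h0'.
  by apply: rV2P; rewrite mxE; lra.
Qed.

(** * The Helly number of dense sets in the plane *)

Theorem theorem1p1 (R : realType) :
  (forall S : set 'rV[R]_2, dense S -> (helly_number S <= 4%:R%:E)%E) /\
  (exists S : set 'rV[R]_2, dense S /\ helly_number S = 4%:R%:E).
Proof.
have le4 (S : set 'rV[R]_2) : dense S -> (helly_number S <= 4%:R%:E)%E.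
  move=> dS; apply: helly_number_le => //; apply: helly_property_criterion => //.
  by move=> x Sx; exact: dense_meets_five_hulls.
split=> //; exists (~` [set 0]); split; first exact: dense_punctured_plane.
apply/eqP; rewrite eq_le le4 ?helly_number_ge //=.
- exact: punctured_plane_helly_gt3.
- exact: dense_punctured_plane.
Qed.
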